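(* Let $(X,\circ,\backslash_{\circ},\bullet,/_{\bullet})$ be a left distributive birack. Then the relation $\sim$ on $X$ defined by $$a\sim b\quad\Leftrightarrow\quad a\circ x=b\circ x\ \text{ for all } x\in X$$ is a congruence of $(X,\circ,\backslash_{\circ},\bullet,/_{\bullet})$, i.e. an equivalence relation compatible with all four operations $\circ,\backslash_{\circ},\bullet,/_{\bullet}$.
   Context: A birack is a set $X$ with four binary operations $\circ,\backslash_{\circ},\bullet,/_{\bullet}$ such that for all $x,y,z\in X$: $x\circ(x\backslash_{\circ} y)=y=x\backslash_{\circ}(x\circ y)$; $(y/_{\bullet}x)\bullet x=y=(y\bullet x)/_{\bullet}x$; $x\circ(y\circ z)=(x\circ y)\circ((x\bullet y)\circ z)$; $(x\circ y)\bullet((x\bullet y)\circ z)=(x\bullet(y\circ z))\circ(y\bullet z)$; $(x\bullet y)\bullet z=(x\bullet(y\circ z))\bullet(y\bullet z)$. The birack is left distributive if $x\circ(y\circ z)=(x\circ y)\circ(x\circ z)$ for all $x,y,z\in X$. Compatibility of $\sim$ with a binary operation $*$ means: $a\sim x$ and $b\sim y$ imply $a*b\sim x*y$. *)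

(* Defs.v *)
From Stdlib Require Import Relation_Definitions.

Declare Scope birack_scope.
Delimit Scope birack_scope with birack.

Record birack : Type := Birack {
  carrier :> Type;
  circ : carrier -> carrier -> carrier;
  lcirc : carrier -> carrier -> carrier; (* [lcirc x y] is x \_circ y *)
  bul : carrier -> carrier -> carrier;
  rbul : carrier -> carrier -> carrier;  (* [rbul y x] is y /_bullet x *)
  circ_lcirc : forall x y, circ x (lcirc x y) = y;
  lcirc_circ : forall x y, lcirc x (circ x y) = y;
  rbul_bul : forall x y, bul (rbul y x) x = y;
  bul_rbul : forall x y, rbul (bul y x) x = y;
  circ_circ : forall x y z,
    circ x (circ y z) = circ (circ x y) (circ (bul x y) z);
  circ_bul : forall x y z,
    bul (circ x y) (circ (bul x y) z) = circ (bul x (circ y z)) (bul y z);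
  bul_bul : forall x y z,
    bul (bul x y) z = bul (bul x (circ y z)) (bul y z)
}.

Arguments circ {b} _ _.
Arguments lcirc {b} _ _.
Arguments bul {b} _ _.
Arguments rbul {b} _ _.

Notation "x ∘ y" := (circ x y) (at level 40, left associativity) : birack_scope.
Notation "x \∘ y" := (lcirc x y) (at level 40, left associativity) : birack_scope.
Notation "x • y" := (bul x y) (at level 40, left associativity) : birack_scope.
Notation "x /• y" := (rbul x y) (at level 40, left associativity) : birack_scope.

Open Scope birack_scope.

Definition left_distributive (X : birack) : Prop :=
  forall x y z : X, x ∘ (y ∘ z) = (x ∘ y) ∘ (x ∘ z).

Definition compatible (X : Type) (R : relation X) (op : X -> X -> X) : Prop :=
  forall a x b y : X, R a x -> R b y -> R (op a b) (op x y).

Record congruence (X : birack) (R : relation X) : Prop := Congruence {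
  cong_equiv : equivalence X R;
  cong_circ : compatible X R circ;
  cong_lcirc : compatible X R lcirc;
  cong_bul : compatible X R bul;
  cong_rbul : compatible X R rbul
}.

Definition sim (X : birack) : relation X :=
  fun a b => forall x : X, a ∘ x = b ∘ x.

(* Main.v *)
(** Write [L x] for the permutation [z ↦ x ∘ z]. The first birack law reads
    [L x L y = L (x ∘ y) L (x • y)] and left distributivity reads
    [L x L y = L (x ∘ y) L x], so [L (x • y) = L x], i.e. [x • y ∼ x]; it follows
    that [x /• y ∼ x]. Moreover [L (x ∘ y)] and [L (x \∘ y)] are
    the conjugates of [L y] by [L x] and by its inverse. *)

Require Import Defs.
From Stdlib Require Import Relation_Definitions.

Lemma circ_inj (X : birack) (x y z : X) : x ∘ y = x ∘ z -> y = z.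
Proof.
  intros H. rewrite <- (lcirc_circ X x y), H. apply lcirc_circ.
Qed.

Lemma sim_equivalence (X : birack) : equivalence X (sim X).
Proof.
  split.
  - intros a x. reflexivity.
  - intros a b c Hab Hbc x. rewrite Hab. apply Hbc.
  - intros a b Hab x. symmetry. apply Hab.
Qed.

(** Equal permutations [L a = L x] have equal inverses. *)
Lemma sim_lcirc_l (X : birack) (a x z : X) : sim X a x -> a \∘ z = x \∘ z.
Proof.
  intros H. apply (circ_inj X a). now rewrite circ_lcirc, H, circ_lcirc.
Qed.

Lemma bul_sim (X : birack) (hX : left_distributive X) (x y : X) : sim X (x • y) x.
Proof.
  (* After applying [L (x ∘ y)], both sides equal [x ∘ (y ∘ z)]. *)
  intros z. apply (circ_inj X (x ∘ y)). now rewrite <- circ_circ, hX.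
Qed.

Lemma rbul_sim (X : birack) (hX : left_distributive X) (x y : X) : sim X (x /• y) x.
Proof.
  (* The class of [x /• y] also contains [(x /• y) • y], which is [x]. *)
  intros z. rewrite <- (bul_sim X hX (x /• y) y). now rewrite rbul_bul.
Qed.

Lemma circ_conj (X : birack) (hX : left_distributive X) (x y z : X) :
  (x ∘ y) ∘ z = x ∘ (y ∘ (x \∘ z)).
Proof.
  rewrite hX. now rewrite circ_lcirc.
Qed.

Lemma lcirc_conj (X : birack) (hX : left_distributive X) (x y z : X) :
  (x \∘ y) ∘ z = x \∘ (y ∘ (x ∘ z)).
Proof.
  apply (circ_inj X x). rewrite hX. now rewrite !circ_lcirc.
Qed.

Theorem theorem3p4 (X : birack) (hX : left_distributive X) :
  congruence X (sim X).
Proof.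
  split.
  - apply sim_equivalence.
  (* A conjugate of [L b] by [L a] is determined by these two permutations, hence by the classes of
     [a] and [b]. *)
  - intros a x b y Ha Hb z. rewrite !(circ_conj X hX).
    now rewrite (sim_lcirc_l X a x z Ha), Hb, Ha.
  - intros a x b y Ha Hb z. rewrite !(lcirc_conj X hX).
    now rewrite (sim_lcirc_l X a x _ Ha), Hb, Ha.
  (* Both sides reduce to the classes of [a] and [x]. *)
  - intros a x b y Ha Hb z. rewrite !(bul_sim X hX). apply Ha.
  - intros a x b y Ha Hb z. rewrite !(rbul_sim X hX). apply Ha.
Qed.
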